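(* Let $E$ be a reflexive Banach space with the approximation property. Then the closed right $\mathcal{B}(E)$-submodules of $E\widehat{\otimes}E'$ are exactly the spaces $F\widehat{\otimes}E'$, for $F$ a closed linear subspace of $E$. The closed left $\mathcal{B}(E)$-submodules of $E\widehat{\otimes}E'$ are exactly the spaces $E\widehat{\otimes}D$, for $D$ a closed linear subspace of $E'$.
   Context: $E'$ is the Banach dual of $E$, $\mathcal{B}(E)$ the algebra of bounded linear operators on $E$, and $\widehat{\otimes}$ the projective tensor product of Banach spaces. $E\widehat{\otimes}E'$ is the predual of $\mathcal{B}(E)$ via $\langle x\otimes\lambda,T\rangle=\lambda(Tx)$, and is a $\mathcal{B}(E)$-bimodule with actions determined by $T\cdot(x\otimes\lambda)=Tx\otimes\lambda$ and $(x\otimes\lambda)\cdot T=x\otimes(\lambda\circ T)$. For closed subspaces $F\subset E$ and $D\subset E'$, $F\widehat{\otimes}E'$ denotes here the closure of the algebraic tensor product $F\otimes E'$ inside $E\widehat{\otimes}E'$, and $E\widehat{\otimes}D$ denotes the closure of $E\otimes D$ inside $E\widehat{\otimes}E'$. $E$ has the approximation property if for every compact $K\subset E$ and every $\varepsilon>0$ there is a bounded finite-rank operator $T$ on $E$ with $\|Tx-x\|<\varepsilon$ for all $x\in K$. *)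

(* Defs.v *)
From HB Require Import structures.
From mathcomp Require Import all_boot all_order all_algebra.
From mathcomp Require Import sesquilinear complex.
From mathcomp Require Import all_classical all_reals.
From mathcomp Require Import topology normedtype sequences.

Set Implicit Arguments.
Unset Strict Implicit.
Unset Printing Implicit Defensive.

Import Order.TTheory GRing.Theory Num.Theory.
Import numFieldNormedType.Exports.

Local Open Scope classical_set_scope.
Local Open Scope ring_scope.

Variant scalar_kind := RealScalars | ComplexScalars.

(* Norms take their values in the scalar field itself; the order of R[i] is the
   partial one, x <= y iff y - x is a nonnegative real. *)
Definition scalars (R : realType) (k : scalar_kind) : numFieldType :=
  match k with RealScalars => R | ComplexScalars => R[i] end.

Lemma complex_sup (R : realType) (A : set R[i]) : A !=set0 ->
  (forall a, A a -> 0 <= a) -> ubound A !=set0 -> supremums A !=set0.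
Proof.
move=> [a0 Aa0] A0 [M AM].
have reE (a : R[i]) : 0 <= a -> a = (complex.Re a)%:C%C.
  by case: a => x y; rewrite lecE /= => /andP[/eqP-> _].
have leE (x y : R) : (x%:C%C <= y%:C%C :> R[i]) = (x <= y).
  by rewrite lecE /= eqxx.
set B := [set complex.Re a | a in A].
have hB : has_sup B.
  split; first by exists (complex.Re a0), a0.
  exists (complex.Re M) => _ [a Aa <-]; move: (AM a Aa).
  by rewrite lecE => /andP[].
exists (sup B)%:C%C; split.
  move=> a Aa; rewrite (reE _ (A0 _ Aa)) leE.
  by apply: (sup_upper_bound hB); exists a.
move=> u Au; have u0 : 0 <= u := le_trans (A0 _ Aa0) (Au _ Aa0).
rewrite (reE _ u0) leE; apply: ge_sup; first by case: hB.
by move=> _ [a Aa <-]; rewrite -leE -!reE// ?Au// A0.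
Qed.

Section bounded_linear.
Context {R : realType} {k : scalar_kind}.
Local Notation K := (scalars R k).

Lemma scalars_sup (A : set K) : A !=set0 ->
  (forall a, A a -> 0 <= a) -> ubound A !=set0 -> supremums A !=set0.
Proof.
case: k A => /= A A0 Age0 ubA; last exact: complex_sup.
have hA : has_sup A by split.
exists (sup A); split; first exact: (sup_upper_bound hA).
by move=> u Au; apply: ge_sup.
Qed.

Implicit Types U V W : normedModType K.

Definition bounded_linear U V : {pred (U -> V)} :=
  fun f => `[< linear f /\ continuous f >].

Record blfun U V := BLFun {
  blfun_val :> U -> V;
  blfunP : blfun_val \in @bounded_linear U V }.

HB.instance Definition _ U V := [isSub for @blfun_val U V].
HB.instance Definition _ U V := [Choice of blfun U V by <:].

Lemma bounded_linear_submod U V : submod_closed (@bounded_linear U V).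
Proof.
split=> [|a f g]; rewrite !inE.
  split=> [b x y|x]; first by rewrite scaler0 addr0.
  exact: cvg_cst.
move=> [fL fC] [gL gC]; split=> [b x y|x].
  have E z : (a *: f + g) z = a *: f z + g z by [].
  by rewrite !E fL gL !scalerDr !scalerA [a * b]mulrC addrACA.
by apply: cvgD; [apply: cvgZr; exact: fC|exact: gC].
Qed.

HB.instance Definition _ U V := GRing.isSubmodClosed.Build K (U -> V)
  (@bounded_linear U V) (@bounded_linear_submod U V).
HB.instance Definition _ U V := [SubChoice_isSubLmodule of blfun U V by <:].

Section theory.
Variables U V : normedModType K.
Implicit Types f g : blfun U V.

Lemma blfun_linear f : linear f.
Proof. by have := blfunP f; rewrite inE => -[]. Qed.

HB.instance Definition _ f :=
  GRing.isLinear.Build K U V *:%R (blfun_val f) (blfun_linear f).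

Lemma blfun_continuous f : continuous f.
Proof. by have := blfunP f; rewrite inE => -[]. Qed.

Lemma blfun_ext f g : (forall x, f x = g x) -> f = g.
Proof. by move=> fg; apply/val_inj/funext. Qed.

Lemma blfunD f g x : (f + g) x = f x + g x. Proof. by []. Qed.

Lemma blfunZ a f x : (a *: f) x = a *: f x. Proof. by []. Qed.

Lemma blfun_bounded f : exists2 c, 0 <= c & forall x, `|f x| <= c * `|x|.
Proof.
have /linear_bounded_continuous/linear_boundedP := @blfun_continuous f.
move=> [M [Mreal fM]]; exists (`|M| + 1); first by rewrite addr_ge0.
move=> x; apply: fM.
by rewrite (le_lt_trans (real_ler_norm Mreal))// ltrDl.
Qed.

Definition opnorm f : K := supremum 0 [set `|f x| | x in [set x | `|x| <= 1]].

Lemma opnormP f : supremums [set `|f x| | x in [set x | `|x| <= 1]] (opnorm f).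
Proof.
have A0 : [set `|f x| | x in [set x | `|x| <= 1]] !=set0.
  by exists `|f 0|, 0 => //=; rewrite normr0.
rewrite /opnorm /supremum; case: ifPn => [/eqP A00|_].
  by rewrite A00 in A0; case: A0.
have [s sP] : supremums [set `|f x| | x in [set x | `|x| <= 1]] !=set0.
  apply: scalars_sup => //; first by move=> _ [x _ <-].
  have [c c0 fc] := blfun_bounded f; exists c => _ [x /= x1 <-].
  by rewrite (le_trans (fc _))// ler_piMr.
exact: (xgetPex 0 (ex_intro _ s sP)).
Qed.

Lemma opnorm_ge0 f : 0 <= opnorm f.
Proof.
have [ub _] := opnormP f; apply: le_trans (ub `|f 0| _) => //.
by exists 0 => //=; rewrite normr0.
Qed.

Lemma le_opnorm f x : `|f x| <= opnorm f * `|x|.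
Proof.
have [->|x0] := eqVneq x 0; first by rewrite linear0 !normr0 mulr0.
have nx0 : 0 < `|x| by rewrite normr_gt0.
have [ub _] := opnormP f; have := ub `|f (`|x|^-1 *: x)|.
rewrite linearZ /= normrZ ger0_norm ?invr_ge0// mulrC ler_pdivrMr//; apply.
exists (`|x|^-1 *: x); last first.
  by rewrite linearZ normrZ ger0_norm ?invr_ge0// mulrC.
by rewrite /= normrZ ger0_norm ?invr_ge0// mulVf// gt_eqF.
Qed.

Lemma opnorm_le f c : 0 <= c -> (forall x, `|f x| <= c * `|x|) -> opnorm f <= c.
Proof.
move=> c0 fc; have [_] := opnormP f; apply => _ [x /= x1 <-].
by rewrite (le_trans (fc _))// ler_piMr.
Qed.

Lemma opnormD f g : opnorm (f + g) <= opnorm f + opnorm g.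
Proof.
apply: opnorm_le => [|x]; first by rewrite addr_ge0 ?opnorm_ge0.
by rewrite (le_trans (ler_normD _ _))// mulrDl lerD ?le_opnorm.
Qed.

Lemma opnormZ a f : opnorm (a *: f) = `|a| * opnorm f.
Proof.
have leZ b g : opnorm (b *: g) <= `|b| * opnorm g.
  apply: opnorm_le => [|x]; first by rewrite mulr_ge0 ?opnorm_ge0.
  by rewrite blfunZ normrZ -mulrA ler_wpM2l ?le_opnorm.
apply/eqP; rewrite eq_le leZ /=; have [->|a0] := eqVneq a 0.
  by rewrite normr0 mul0r opnorm_ge0.
rewrite -ler_pdivlMl ?normr_gt0// -normfV.
by rewrite -{1}[f]scale1r -(mulVf a0) -scalerA leZ.
Qed.

Lemma opnorm0_eq0 f : opnorm f = 0 -> f = 0.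
Proof.
move=> f0; apply: blfun_ext => x; apply/normr0_eq0/eqP.
by rewrite eq_le normr_ge0 (le_trans (le_opnorm f x))// f0 mul0r.
Qed.

HB.instance Definition _ :=
  Lmodule_isNormed.Build K (blfun U V) opnormD opnormZ opnorm0_eq0.

End theory.


Lemma boundedBL U V (f : U -> V) (c : K) : linear f ->
  (forall x, `|f x| <= c * `|x|) -> f \in @bounded_linear U V.
Proof.
move=> fL fc; rewrite inE; split=> //.
pose g : {linear U -> V} := HB.pack f (GRing.isLinear.Build K U V *:%R f fL).
apply: (@bounded_linear_continuous _ _ _ g); apply/linear_boundedP.
exists `|c|; split=> [|r cr x]; first exact: normr_real.
rewrite (le_trans (fc x))//.
have [->|x0] := eqVneq x 0; first by rewrite normr0 !mulr0.
have nx0 : 0 < `|x| by rewrite normr_gt0.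
have c0 : 0 <= c by rewrite -(pmulr_lge0 _ nx0) (le_trans _ (fc x)).
by rewrite ler_pM2r// (le_trans _ (ltW cr))// real_ler_norm// ger0_real.
Qed.

Lemma blcomp_subproof U V W (g : blfun V W) (f : blfun U V) :
  g \o f \in @bounded_linear U W.
Proof.
apply: (@boundedBL _ _ (g \o f) (`|g| * `|f|)).
  by move=> a x y; rewrite /= !linearP.
move=> x; rewrite (le_trans (le_opnorm g _))// -mulrA.
by apply: ler_wpM2l; [exact: opnorm_ge0|exact: le_opnorm].
Qed.

Definition blcomp U V W (g : blfun V W) (f : blfun U V) : blfun U W :=
  BLFun (blcomp_subproof g f).

Definition dual U := blfun U K^o.

Definition closed_subspace U (A : set U) := [/\ closed A, A 0 &
  forall (a : K) x y, A x -> A y -> A (a *: x + y)].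

(* Surjectivity of the canonical map from U to its bidual. *)
Definition reflexive_space U :=
  forall Phi : dual (dual U), exists x : U, forall l : dual U, Phi l = l x.

Definition finite_rank U V (T : blfun U V) := exists (n : nat) (e : 'I_n -> V),
  forall x, exists a : 'I_n -> K, T x = \sum_i a i *: e i.

Definition approximation_property U := forall C : set U, compact C ->
  forall eps : K, 0 < eps ->
  exists2 T : blfun U U, finite_rank T & forall x, C x -> `|T x - x| < eps.

(* A list of pairs stands for the sum of the corresponding elementary tensors;
   two lists define the same element of the algebraic tensor product when no
   bilinear map to any vector space distinguishes them. *)
Definition tensor_eq U V (s1 s2 : seq (U * V)) :=
  forall (W : lmodType K) (b : {bilinear U -> V -> W}),
    \sum_(p <- s1) b p.1 p.2 = \sum_(p <- s2) b p.1 p.2.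

Definition projective_costs U V (s : seq (U * V)) : set K :=
  [set \sum_(p <- s') `|p.1| * `|p.2| | s' in tensor_eq s].

(* A completion of the algebraic tensor product for the projective norm (the
   norm is the greatest lower bound of the costs of the representations). It is
   unique up to a unique isometric isomorphism compatible with [tens]. *)
Record projective_tensor U V := ProjectiveTensor {
  tensor_space :> completeNormedModType K ;
  tens : {bilinear U -> V -> tensor_space} ;
  tens_norm : forall s : seq (U * V),
    infimums (projective_costs s) `|\sum_(p <- s) tens p.1 p.2| ;
  tens_dense :
    dense (range (fun s : seq (U * V) => \sum_(p <- s) tens p.1 p.2)) }.

(* For subspaces A and B, the sums below run over the algebraic tensor product
   of A and B inside P. *)
Definition tensor_closure U V (P : projective_tensor U V)
    (A : set U) (B : set V) : set P :=
  closure [set \sum_(p <- s) tens P p.1 p.2 |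
    s in [set s : seq (U * V) | forall p, p \in s -> A p.1 /\ B p.2]].

Section lift.
Variables (U V : normedModType K) (P : projective_tensor U V).
Variables (Z : completeNormedModType K) (b : {bilinear U -> V -> Z}) (c : K).
Hypothesis b_le : forall x y, `|b x y| <= c * (`|x| * `|y|).

Let S (s : seq (U * V)) : P := \sum_(p <- s) tens P p.1 p.2.
Let B (s : seq (U * V)) : Z := \sum_(p <- s) b p.1 p.2.
Let scale (a : K) (s : seq (U * V)) := [seq (a *: p.1, p.2) | p <- s].

Let S_cat s1 s2 : S (s1 ++ s2) = S s1 + S s2. Proof. exact: big_cat. Qed.
Let B_cat s1 s2 : B (s1 ++ s2) = B s1 + B s2. Proof. exact: big_cat. Qed.

Let S_scale a s : S (scale a s) = a *: S s.
Proof.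
by rewrite /S big_map scaler_sumr; apply: eq_bigr => p _; rewrite /= linearZl.
Qed.

Let B_scale a s : B (scale a s) = a *: B s.
Proof.
by rewrite /B big_map scaler_sumr; apply: eq_bigr => p _; rewrite /= linearZl.
Qed.

Let C : K := `|c| + 1.

Let C0 : 0 < C. Proof. by rewrite ltr_wpDl. Qed.

Let b_leC x y : `|b x y| <= C * (`|x| * `|y|).
Proof.
have xy0 : 0 <= `|x| * `|y| by rewrite mulr_ge0.
have [z|xy] := eqVneq (`|x| * `|y|) 0.
  by rewrite (le_trans (b_le x y))// z !mulr0.
have xyp : 0 < `|x| * `|y| by rewrite lt_def xy.
rewrite (le_trans (b_le x y))// ler_pM2r// (@le_trans _ _ `|c|)//.
  apply/real_ler_norm/ger0_real.
  by rewrite -(pmulr_lge0 _ xyp) (le_trans _ (b_le x y)).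
by rewrite lerDl.
Qed.

Let B_le s : `|B s| <= C * `|S s|.
Proof.
have [_ lb] := tens_norm P s.
rewrite -ler_pdivrMl//; apply: lb => _ [s' ss' <-].
rewrite ler_pdivrMl// /B (ss' _ b) (le_trans (ler_norm_sum _ _ _))// mulr_sumr.
by apply: ler_sum => p _; exact: b_leC.
Qed.

Let BB_le s1 s2 : `|B s1 - B s2| <= C * `|S s1 - S s2|.
Proof.
have := B_le (s1 ++ scale (-1) s2).
by rewrite B_cat S_cat B_scale S_scale !scaleN1r.
Qed.

Let F (u : P) := 
  filter_from [set e : K | 0 < e] (fun e => [set s | `|u - S s| < e]).

Let F_filter u : ProperFilter (F u).
Proof.
apply: filter_from_proper; [apply: filter_from_filter|].
- by exists 1 => /=.
- move=> e1 e2 /= e10 e20.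
  have [le12|/ltW le21] := real_leP (gtr0_real e10) (gtr0_real e20).
    by exists e1 => // s /= us; split=> //; apply: lt_le_trans le12.
  by exists e2 => // s /= us; split=> //; apply: lt_le_trans le21.
- move=> e /= e0.
  have [] := @tens_dense _ _ P (ball u e).
  + by exists u; exact: ballxx.
  + exact: ball_open.
  by move=> x [ue [s _ sx]]; exists s; move: ue; rewrite -sx -ball_normE.
Qed.

Let F_lt u e : 0 < e -> F u [set s | `|u - S s| < e].
Proof. by exists e. Qed.

Let L u : Z := lim (B @ F u).

Let L_le u s : `|L u - B s| <= C * `|u - S s|.
Proof.
have FF := F_filter u; have cvgL : B @ F u --> L u.
  apply: cauchy_cvg; apply: cauchy_exP => e e0.
  have e1 : 0 < e / C / 2 by rewrite !divr_gt0.
  have [s0 /= us0] := filter_ex (F_lt u e1).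
  exists (B s0); apply: filterS (F_lt u e1) => s1 /= us1.
  rewrite -ball_normE /= (le_lt_trans (BB_le _ _))//.
  have : `|S s0 - S s1| < e / C.
    rewrite [ltRHS]splitr -(subrKA u) (le_lt_trans (ler_normD _ _))// ltrD//.
    by rewrite distrC.
  by rewrite ltr_pdivlMr// mulrC.
apply/ler_addgt0Pr => e e0; pose d := e / (1 + C).
have d0 : 0 < d by rewrite divr_gt0// addr_gt0.
have [s' /= [Ld ud]] := filter_ex (filterI
  ((cvgrPdist_lt _ _).1 cvgL d d0) (F_lt u d0)).
rewrite -(subrKA (B s')) (le_trans (ler_normD _ _))//.
have -> : C * `|u - S s| + e = d + C * (d + `|u - S s|).
  rewrite mulrDr addrA -[X in X + C * d]mul1r -mulrDl addrC; congr (_ + _).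
  by rewrite mulrC divfK// gt_eqF// addr_gt0.
rewrite lerD ?(ltW Ld)// (le_trans (BB_le _ _))// ler_wpM2l ?(ltW C0)//.
rewrite -(subrKA u) (le_trans (ler_normD _ _))// lerD// distrC; exact: ltW.
Qed.

Let L_linear : linear L.
Proof.
move=> a u v; apply/subr0_eq/normr0_eq0/eqP; rewrite eq_le normr_ge0 andbT.
apply/ler_addgt0Pr => e e0; rewrite add0r.
pose d := e / ((C + C) * (`|a| + 1)).
have a1 : 0 < `|a| + 1 by rewrite ltr_wpDl.
have D0 : 0 < (C + C) * (`|a| + 1) by rewrite mulr_gt0// addr_gt0.
have d0 : 0 < d by rewrite divr_gt0.
have Fu := F_filter u; have Fv := F_filter v.
have [s us] := filter_ex (F_lt u d0); have [t vt] := filter_ex (F_lt v d0).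
have H : `|a *: u + v - (a *: S s + S t)| <= d * (`|a| + 1).
  rewrite opprD addrACA -scalerBr (le_trans (ler_normD _ _))// normrZ.
  by rewrite mulrDr mulr1 mulrC lerD ?(ltW vt)// ler_wpM2r// ltW.
have := L_le (a *: u + v) (scale a s ++ t).
rewrite S_cat B_cat S_scale B_scale => H1.
have H2 : `|a *: L u + L v - (a *: B s + B t)| <= C * (d * (`|a| + 1)).
  rewrite opprD addrACA -scalerBr (le_trans (ler_normD _ _))// normrZ.
  rewrite mulrA mulrDr mulr1 [C * d * _]mulrC lerD//.
    by rewrite ler_wpM2l// (le_trans (L_le _ _))// ler_pM2l// ltW.
  by rewrite (le_trans (L_le _ _))// ler_pM2l// ltW.
rewrite -(subrKA (a *: B s + B t)) (le_trans (ler_normD _ _))//.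
have -> : e = C * (d * (`|a| + 1)) + C * (d * (`|a| + 1)).
  by rewrite -mulrDl mulrCA divfK// gt_eqF.
rewrite lerD//; first by rewrite (le_trans H1)// ler_pM2l.
by rewrite distrC.
Qed.

Lemma lift_exists : exists f : blfun P Z, forall x y, f (tens P x y) = b x y.
Proof.
have LP : L \in @bounded_linear P Z.
  apply: (@boundedBL _ _ _ C) => // u.
  by have := L_le u [::]; rewrite /S /B !big_nil !subr0.
exists (BLFun LP) => x y /=; apply/subr0_eq/normr0_eq0/eqP.
rewrite eq_le normr_ge0 andbT.
by have := L_le (tens P x y) [:: (x, y)];
  rewrite /S /B !big_seq1 subrr normr0 mulr0.
Qed.

End lift.

(* The maps f \in blfun P Z are determined by their values on elementary
   tensors. *)
Lemma tens_ext U V (P : projective_tensor U V) W (f g : blfun P W) :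
  (forall x y, f (tens P x y) = g (tens P x y)) -> f = g.
Proof.
move=> fg; apply: blfun_ext => u; apply/subr0_eq.
have [h hE] : exists h : blfun P W, forall z, h z = f z - g z.
  by exists (f - g).
rewrite -hE; have [M M0 hM] := blfun_bounded h.
have M1 : 0 < M + 1 by rewrite ltr_wpDl.
apply/normr0_eq0/eqP; rewrite eq_le normr_ge0 andbT.
apply/ler_addgt0Pr => e e0; rewrite add0r.
have [] := @tens_dense _ _ P (ball u (e / (M + 1))).
- by exists u; apply: ballxx; rewrite divr_gt0.
- by apply: ball_open; rewrite divr_gt0.
move=> x [us [s _ sx]]; move: us; rewrite -sx -ball_normE /= => us.
have hs : h (\sum_(p <- s) tens P p.1 p.2) = 0.
  rewrite linear_sum big1// => p _.
  by apply: etrans (hE _) _; rewrite fg subrr.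
rewrite -[h u]subr0 -hs -linearB (le_trans (hM _))//.
rewrite (@le_trans _ _ ((M + 1) * (e / (M + 1))))//.
  by rewrite ler_pM ?(ltW us)// lerDl.
by rewrite mulrC divfK// gt_eqF.
Qed.

Section bimodule.
Variables (E : normedModType K) (P : projective_tensor E (dual E)).
Implicit Type T : blfun E E.

Definition lact_tens T (x : E) (l : dual E) : P := tens P (T x) l.
Definition ract_tens T (x : E) (l : dual E) : P := tens P x (blcomp l T).

Lemma lact_tens_bilinear T : bilinear_for *:%R *:%R (lact_tens T).
Proof.
by split=> [l a x y|x a l m]; rewrite /lact_tens ?linearP ?linearPr ?linearPl.
Qed.

Lemma ract_tens_bilinear T : bilinear_for *:%R *:%R (ract_tens T).
Proof.
split=> [l a x y|x a l m]; rewrite /ract_tens; first by rewrite linearPl.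
by rewrite -linearPr; congr (tens P x _); apply: blfun_ext.
Qed.

HB.instance Definition _ T := bilinear_isBilinear.Build K E (dual E) P
  *:%R *:%R (lact_tens T) (lact_tens_bilinear T).
HB.instance Definition _ T := bilinear_isBilinear.Build K E (dual E) P
  *:%R *:%R (ract_tens T) (ract_tens_bilinear T).

Lemma tens_le (x : E) (l : dual E) : `|tens P x l| <= `|x| * `|l|.
Proof.
have [lb _] := tens_norm P [:: (x, l)]; rewrite big_seq1 in lb.
by apply: lb; exists [:: (x, l)] => //; rewrite big_seq1.
Qed.

Lemma lact_exists T :
  exists f : blfun P P, forall x l, f (tens P x l) = tens P (T x) l.
Proof.
apply: (@lift_exists _ _ P P (lact_tens T : {bilinear _ -> _ -> _})
  `|T|) => x l.
by rewrite (le_trans (tens_le _ _))// mulrA ler_wpM2r// le_opnorm.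
Qed.

Lemma ract_exists T :
  exists f : blfun P P, forall x l, f (tens P x l) = tens P x (blcomp l T).
Proof.
apply: (@lift_exists _ _ P P (ract_tens T : {bilinear _ -> _ -> _})
  `|T|) => x l.
rewrite (le_trans (tens_le _ _))// mulrCA ler_wpM2l//.
apply: opnorm_le => [|y]; first by rewrite mulr_ge0.
apply: le_trans (le_opnorm l _) _; rewrite [leRHS]mulrAC [leRHS]mulrC.
by apply: ler_wpM2l; [exact: opnorm_ge0|exact: le_opnorm].
Qed.

(* By [tens_ext] these actions are the only ones satisfying [lactE], [ractE]. *)
Definition lact T : blfun P P := projT1 (cid (lact_exists T)).
Definition ract T : blfun P P := projT1 (cid (ract_exists T)).

Lemma lactE T x l : lact T (tens P x l) = tens P (T x) l.
Proof. by rewrite /lact; case: cid. Qed.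

Lemma ractE T x l : ract T (tens P x l) = tens P x (blcomp l T).
Proof. by rewrite /ract; case: cid. Qed.

Definition closed_left_submodule (M : set P) :=
  closed_subspace M /\ forall T u, M u -> M (lact T u).

Definition closed_right_submodule (M : set P) :=
  closed_subspace M /\ forall T u, M u -> M (ract T u).

End bimodule.

End bounded_linear.

Arguments tensor_closure {R k U V} P A B _.

(* Main.v *)
(* A submodule M is recovered from its factor space: the x with x (x) E'
   contained in M in the right case, the l with E (x) l contained in M in the
   left case. For T = y (x) m of rank one, u . T and T . u are elementary
   tensors with one factor equal to m, respectively y, and the other one a slice
   of u, which lies in the factor space of M when u is in M. It remains to
   approximate u by such elements. On the left, the approximation property gives
   T . u -> u with T of finite rank, because u is an absolutely convergent sum of
   elementary tensors whose first factors form a null sequence. On the right,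
   Hahn-Banach is used: by reflexivity a functional vanishing on F (x) E' is
   u |-> tr(S u) for some S in B(E), the trace tr(T S u) vanishes for every T of
   finite rank, and T . (S u) -> S u. *)
Require Import Defs.
From HB Require Import structures.
From mathcomp Require Import all_boot all_order all_algebra.
From mathcomp Require Import sesquilinear complex.
From mathcomp Require Import all_classical all_reals.
From mathcomp Require Import topology normedtype.
From mathcomp Require Import ring lra.

Set Implicit Arguments.
Unset Strict Implicit.
Unset Printing Implicit Defensive.

Import Order.TTheory GRing.Theory Num.Theory.
Import numFieldNormedType.Exports.

Local Open Scope classical_set_scope.
Local Open Scope ring_scope.

(** * Sublinear functionals and their minimal elements *)

Section sublinear.
Variables (R : realType) (V : lmodType R).
Implicit Types (p q : V -> R) (x y e : V).

Definition sublinear q := (forall x y, q (x + y) <= q x + q y) /\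
  (forall (t : R) x, 0 <= t -> q (t *: x) <= t * q x).

Lemma sublinearZ q (t : R) x : sublinear q -> 0 <= t -> q (t *: x) = t * q x.
Proof.
move=> [_ qZ]; rewrite le0r => /predU1P[->|t0]; last first.
  apply/eqP; rewrite eq_le qZ ?(ltW t0)//= -ler_pdivlMl//.
  by rewrite -{1}(scalerK (lt0r_neq0 t0) x) qZ// invr_ge0 ltW.
apply/eqP; rewrite eq_le qZ//= mul0r scale0r.
have := qZ 2 0; rewrite scaler0 => /(_ (ler0n _ _)); lra.
Qed.

Lemma sublinear0 q : sublinear q -> q 0 = 0.
Proof. by move=> qS; rewrite -(scale0r 0) sublinearZ// mul0r. Qed.

Lemma sublinear_ge q x : sublinear q -> - q (- x) <= q x.
Proof.
by move=> qS; have := qS.1 x (- x); rewrite subrr sublinear0//; lra.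
Qed.

(** For sublinear [q] this is the greatest sublinear functional below [q] whose value at [- e] is at
    most [- q e]. *)
Definition sublinear_shift q e x : R :=
  inf [set q (x + t *: e) - t * q e | t in [set t | 0 <= t]].

Section shift.
Variables (q : V -> R) (e : V).
Hypothesis qS : sublinear q.

Lemma sublinear_shift_le x t : 0 <= t ->
  sublinear_shift q e x <= q (x + t *: e) - t * q e.
Proof.
move=> t0; apply: ge_inf; last by exists t.
exists (- q (- x)) => _ [s /= s0 <-].
have := qS.1 (x + s *: e) (- x); rewrite addrAC subrr add0r (sublinearZ _ qS)//.
lra.
Qed.

Lemma le_sublinear_shift x a :
  (forall t, 0 <= t -> a <= q (x + t *: e) - t * q e) ->
  a <= sublinear_shift q e x.
Proof.
move=> h; apply: lb_le_inf; first by exists (q (x + 0 *: e) - 0 * q e), 0 => /=.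
by move=> _ [t /= t0 <-]; exact: h.
Qed.

Lemma sublinear_shift_sublinear : sublinear (sublinear_shift q e).
Proof.
split=> [x y|t x].
  rewrite -lerBlDr; apply: le_sublinear_shift => s s0.
  rewrite lerBlDr -lerBlDl; apply: le_sublinear_shift => t t0.
  (* Parameters [s] for [x] and [t] for [y] combine into the parameter [s + t] for [x + y]. *)
  have := @sublinear_shift_le (x + y) (s + t) (addr_ge0 s0 t0).
  have := qS.1 (x + s *: e) (y + t *: e); rewrite addrACA -scalerDl mulrDl; lra.
rewrite le0r => /predU1P[->|t0].
  rewrite mul0r; apply: le_trans (@sublinear_shift_le _ 0 (lexx _)) _.
  by rewrite !scale0r addr0 mul0r subr0 sublinear0.
rewrite mulrC -ler_pdivrMr//; apply: le_sublinear_shift => s s0.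
rewrite ler_pdivrMr// mulrC.
apply: le_trans (@sublinear_shift_le _ (t * s) _) _.
  by rewrite mulr_ge0// ltW.
by rewrite -scalerA -scalerDr (sublinearZ _ qS) ?(ltW t0)// mulrBr mulrA.
Qed.

Lemma sublinear_shift_le_self x : sublinear_shift q e x <= q x.
Proof.
apply: le_trans (@sublinear_shift_le _ 0 (lexx _)) _.
by rewrite scale0r addr0 mul0r subr0.
Qed.

Lemma sublinear_shiftN : sublinear_shift q e (- e) <= - q e.
Proof.
apply: le_trans (@sublinear_shift_le _ 1 ler01) _.
by rewrite scale1r addNr mul1r sublinear0// sub0r.
Qed.

End shift.

(** Zorn's lemma for the reversed pointwise order [r]. A nonempty chain is bounded by its pointwise
    infimum, which is finite because every member is at least [- p (- x)] at [x]. *)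
Lemma sublinear_minimal p : sublinear p -> exists q, [/\ sublinear q,
  forall x, q x <= p x & forall q', sublinear q' ->
    (forall x, q' x <= q x) -> q' = q].
Proof.
move=> pS; pose T := {q : V -> R | sublinear q /\ forall x, q x <= p x}.
pose r (s t : T) := `[< forall x, sval t x <= sval s x >].
have [||||[q [qS qp]] qm] := @Zorn T r.
- by move=> t; apply/asboolP.
- move=> a b c /asboolP ab /asboolP bc; apply/asboolP => x.
  exact: le_trans (bc x) (ab x).
- move=> [a a'] [b b'] /asboolP/= ab /asboolP/= ba; apply: eq_exist => /=.
  by apply/funext => x; apply/eqP; rewrite eq_le ab ba.
- move=> A Atot; have [[q0 Aq0]|A0] := pselect (A !=set0); last first.
    by exists (exist _ p (conj pS (fun=> lexx _))) => s As; case: A0; exists s.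
  pose m x := inf [set sval s x | s in A].
  have m_le s x : A s -> m x <= sval s x.
    move=> As; apply: ge_inf; last by exists s.
    exists (- p (- x)) => _ [[t [tS tp]] At <-] /=.
    by have := sublinear_ge x tS; have := tp (- x); lra.
  have le_m x a : (forall s, A s -> a <= sval s x) -> a <= m x.
    move=> h; apply: lb_le_inf; first by exists (sval q0 x), q0.
    by move=> _ [s As <-]; exact: h.
  have mS : sublinear m.
    split=> [x y|t x t0].
      rewrite -lerBlDr; apply: (le_m _ _) => s As.
      rewrite lerBlDr -lerBlDl; apply: (le_m _ _) => s' As'.
      (* Of two members of the chain, the smaller one can be used at both [x] and [y], so its
         subadditivity suffices. *)
      have [/asboolP ss'|/asboolP s's] := Atot _ _ As As'.
        have := m_le _ (x + y) As'; have := (svalP s').1.1 x y.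
        have := ss' x; lra.
      have := m_le _ (x + y) As; have := (svalP s).1.1 x y.
      have := s's y; lra.
    move: t0; rewrite le0r => /predU1P[->|t0].
      have := m_le _ 0 Aq0.
      by rewrite scale0r mul0r (sublinear0 (svalP q0).1).
    rewrite mulrC -ler_pdivrMr//; apply: (le_m _ _) => s As.
    rewrite ler_pdivrMr// mulrC -(sublinearZ _ (svalP s).1) ?(ltW t0)//.
    exact: m_le.
  have mp x : m x <= p x by apply: le_trans (m_le _ _ Aq0) ((svalP q0).2 x).
  exists (exist _ m (conj mS mp)) => s As; apply/asboolP => x /=.
  exact: m_le.
exists q; split=> // q' q'S q'q.
have q'p x : q' x <= p x by exact: le_trans (qp x).
have /(congr1 sval)//= : exist _ q' (conj q'S q'p) = exist _ q (conj qS qp) :> T.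
by apply: qm; apply/asboolP.
Qed.

(* A minimal sublinear functional [q] is odd, hence linear: it coincides with
   its shift in any direction [e], so that q (- e) <= - q e. *)
Lemma sublinear_linear p e : sublinear p -> exists g : V -> R,
  [/\ linear (g : V -> R^o), forall x, g x <= p x & g e = p e].
Proof.
(* Minimizing below the shift of [p] along [e], rather than below [p], forces [q (- e) <= - p e],
   hence [q e = p e]. *)
move=> pS; have [q [qS qp qm]] :=
  sublinear_minimal (sublinear_shift_sublinear e pS).
have qN x : q (- x) = - q x.
  have := qm _ (sublinear_shift_sublinear x qS) (sublinear_shift_le_self x qS).
  move=> qE; have := sublinear_shiftN x qS; rewrite qE.
  by have := sublinear_ge x qS; lra.
have qD x y : q (x + y) = q x + q y.
  have := qS.1 (- x) (- y); rewrite -opprD !qN; have := qS.1 x y; lra.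
have qle x : q x <= p x by apply: le_trans (qp x) (sublinear_shift_le_self e pS x).
exists q; split=> // [a x y|].
  rewrite qD; congr (_ + _); have [a0|/ltW a0] := leP 0 a.
    exact: sublinearZ.
  by rewrite -[LHS]opprK -qN -scaleNr (sublinearZ _ qS) ?oppr_ge0// mulNr opprK.
have := qp (- e); rewrite qN; have := sublinear_shiftN e pS; have := qle e; lra.
Qed.

End sublinear.

(** * Complex vector spaces regarded as real ones *)

Section restriction_of_scalars.
Variables (R : realType) (V : lmodType R[i]).

Definition realified : Type := V.
HB.instance Definition _ := GRing.Zmodule.on realified.

Definition real_scale (a : R) (x : realified) : realified := a%:C%C *: (x : V).

Fact real_scaleA a b x : real_scale a (real_scale b x) = real_scale (a * b) x.
Proof. by rewrite /real_scale scalerA rmorphM. Qed.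
Fact real_scale1 : left_id 1 real_scale.
Proof. by move=> x; rewrite /real_scale scale1r. Qed.
Fact real_scaleDr : right_distributive real_scale +%R.
Proof. by move=> a x y; rewrite /real_scale scalerDr. Qed.
Fact real_scaleDl x : {morph real_scale^~ x : a b / a + b}.
Proof. by move=> a b; rewrite /real_scale rmorphD scalerDl. Qed.

HB.instance Definition _ := GRing.Zmodule_isLmodule.Build R realified
  real_scaleA real_scale1 real_scaleDr real_scaleDl.

End restriction_of_scalars.

(** * Hahn-Banach for real seminorms *)

Section hahn_banach.
Variables (R : realType).

Lemma real_hahn_banach (V : lmodType R) (p : V -> R) (e : V) :
  (forall x y, p (x + y) <= p x + p y) ->
  (forall a x, p (a *: x) <= `|a| * p x) ->
  exists2 l : V -> R^o, linear l & (forall x, `|l x| <= p x) /\ `|l e| = p e.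
Proof.
move=> pD pZ; have pS : sublinear p.
  by split=> // t x t0; rewrite -{2}(ger0_norm t0).
have [g [gL gp ge]] := sublinear_linear e pS.
have gle x : `|g x| <= p x.
  rewrite ler_norml gp andbT.
  have gN : g (- x) = - g x.
    have := gL (-1) x 0; have := gL (-1) 0 0.
    by rewrite scaler0 !addr0 !scaleN1r addNr => ->; rewrite addr0.
  have := gp (- x); rewrite gN; have := pZ (-1) x.
  by rewrite scaleN1r normrN1 mul1r; lra.
exists g => //; split=> //; apply/eqP; rewrite eq_le gle /= -ge.
exact: ler_norm.
Qed.

End hahn_banach.

(** * Hahn-Banach for complex seminorms, then for either scalar field *)

Section hahn_banach.
Context {R : realType}.

Lemma ge0_complexE (a : R[i]) : 0 <= a -> a = (complex.Re a)%:C%C.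
Proof. by case: a => x y; rewrite lecE /= => /andP[/eqP-> _]. Qed.

Lemma lec_real (x y : R) : (x%:C%C <= y%:C%C :> R[i]) = (x <= y).
Proof. by rewrite lecE /= eqxx. Qed.

(* A real functional [g] dominated by [p] is the real part of
   [x |-> g x - i g (i x)]; rotating x bounds the modulus of the latter. *)
Lemma complex_hahn_banach (V : lmodType R[i]) (p : V -> R[i]) (e : V) :
  (forall x, 0 <= p x) ->
  (forall x y, p (x + y) <= p x + p y) ->
  (forall a x, p (a *: x) <= `|a| * p x) ->
  exists2 l : V -> (R[i])^o, linear l &
    (forall x, `|l x| <= p x) /\ `|l e| = p e.
Proof.
move=> p0 pD pZ; pose q (x : realified V) : R := complex.Re (p x).
have pE x : p x = (q x)%:C%C by exact: ge0_complexE.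
have qD (x y : realified V) : q (x + y) <= q x + q y.
  by rewrite -lec_real rmorphD/= -!pE; exact: pD.
have qZ (a : R) (x : realified V) : q (a *: x) <= `|a| * q x.
  have := pZ a%:C%C x; rewrite !pE normc_def/= expr0n addr0 sqrtr_sqr.
  by rewrite -rmorphM/= lec_real.
have qS : sublinear q.
  by split=> // t x t0; rewrite -{2}(ger0_norm t0).
have [g [gL gp ge]] := sublinear_linear (e : realified V) qS.
have gD (x y : V) : g (x + y) = g x + g y.
  by have := gL 1 x y; rewrite !scale1r.
have gZ (a : R) (x : V) : g (a%:C%C *: x) = a * g x.
  have := gL a x 0; have := gL (-1) 0 0.
  by rewrite scaler0 !addr0 !scaleN1r addNr => ->; rewrite addr0.
pose l (x : V) : R[i] := (g x -i* g ('i%C *: x))%C.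
have lD x y : l (x + y) = l x + l y.
  by rewrite /l scalerDr !gD opprD.
have lZ a x : l (a *: x) = a * l x.
  case: a => a b; have -> : (a +i* b)%C = a%:C%C + b%:C%C * 'i%C :> R[i].
    by apply/eqP; rewrite eq_complex/=; apply/andP; split; apply/eqP; ring.
  rewrite /l scalerDl scalerDr !scalerA !gD.
  have -> : 'i%C * (b%:C%C * 'i%C) = (- b)%:C%C :> R[i].
    by apply/eqP; rewrite eq_complex/=; apply/andP; split; apply/eqP; ring.
  rewrite ['i%C * _]mulrC -!scalerA !gZ.
  by apply/eqP; rewrite eq_complex/=; apply/andP; split; apply/eqP; ring.
have Rel x : complex.Re (l x) = g x by [].
have lp x : `|l x| <= p x.
  have [->|lx0] := eqVneq (l x) 0; first by rewrite normr0.
  have nl0 : 0 < `|l x| by rewrite normr_gt0.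
  pose t := `|l x| / l x.
  have t1 : `|t| = 1 by rewrite normrM normfV normr_id divff// gt_eqF.
  have ltx : l (t *: x) = `|l x| by rewrite lZ /t divfK.
  rewrite (ge0_complexE (normr_ge0 _)) -ltx Rel.
  apply: le_trans (_ : p (t *: x) <= _); first by rewrite pE lec_real gp.
  by rewrite (le_trans (pZ _ _))// t1 mul1r.
exists l; first by move=> a x y; rewrite lD lZ.
(* Conversely [p e] is the real part of [l e], which its modulus dominates. *)
split=> //; apply/eqP; rewrite eq_le lp /= pE -ge -Rel.
rewrite (ge0_complexE (normr_ge0 _)) lec_real.
by rewrite -lec_real (le_trans _ (normc_ge_Re _))// lec_real ler_norm.
Qed.

Lemma seminorm_functional k (V : lmodType (scalars R k))
    (p : V -> scalars R k) (e : V) :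
  (forall x, 0 <= p x) ->
  (forall x y, p (x + y) <= p x + p y) ->
  (forall a x, p (a *: x) <= `|a| * p x) ->
  exists2 l : V -> (scalars R k)^o, linear l &
    (forall x, `|l x| <= p x) /\ `|l e| = p e.
Proof.
case: k V p e => /= V p e; last exact: complex_hahn_banach.
by move=> _; exact: real_hahn_banach.
Qed.

End hahn_banach.

(** * Separation by functionals, finite-rank operators, compact null sequences *)

Section functional_analysis.
Context {R : realType} {k : scalar_kind}.
Local Notation K := (scalars R k).
Implicit Types U V W : normedModType K.

(** A positive element of [R[i]] is real, so the archimedean property of [R] applies in both
    cases. *)
Lemma ex_pow2_lt (e : K) : 0 < e -> exists n, 2 ^- n < e.
Proof.
have real_case (r : R) : 0 < r -> exists n, 2 ^- n < r.
  move=> r0; exists (Num.trunc r^-1).+1.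
  rewrite invf_plt ?posrE ?exprn_gt0//.
  apply: lt_trans (_ : (Num.trunc r^-1).+1%:R < _).
    by rewrite Num.Theory.truncnS_gt.
  by rewrite -natrX ltr_nat ltn_expl.
case: k e => /= [|e e0]; first exact: real_case.
have [|n ne] := real_case (complex.Re e).
  by move: e0; rewrite ltcE => /andP[].
exists n; rewrite (ge0_complexE (ltW e0)).
suff -> : 2 ^- n = (2 ^- n : R)%:C%C :> R[i] by rewrite ltcE /= eqxx.
by rewrite fmorphV rmorphXn rmorph_nat.
Qed.

Lemma dualZ U (l : dual U) (a : K) x : l (a *: x) = a * l x.
Proof. exact: linearZ. Qed.

Lemma norming_functional U (e : U) :
  exists l : dual U, (forall x, `|l x| <= `|x|) /\ `|l e| = `|e|.
Proof.
have [|||l lL [l1 le]] := @seminorm_functional R k U (fun x => `|x|) e.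
- by [].
- exact: ler_normD.
- by move=> a x; rewrite normrZ.
have lB : l \in @bounded_linear R k U K^o.
  by apply: (boundedBL lL (c := 1)) => x; rewrite mul1r.
by exists (BLFun lB).
Qed.

Lemma ex_functional_eq1 U (e : U) : e != 0 -> exists l : dual U, l e = 1.
Proof.
move=> e0; have [l [_ le]] := norming_functional e.
have le0 : l e != 0 by rewrite -normr_eq0 le normr_eq0.
by exists ((l e)^-1 *: l); rewrite blfunZ; exact: mulVf.
Qed.

Lemma dual_separating U (x : U) : (forall l : dual U, l x = 0) -> x = 0.
Proof.
move=> lx; apply/eqP/negPn/negP => /ex_functional_eq1[l].
by rewrite lx => /eqP; rewrite eq_sym oner_eq0.
Qed.

Lemma subspaceD U (N : set U) x y : closed_subspace N -> N x -> N y -> N (x + y).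
Proof. by case=> _ _ h Nx Ny; rewrite -[x]scale1r; exact: h. Qed.

Lemma subspaceZ U (N : set U) (a : K) x : closed_subspace N -> N x -> N (a *: x).
Proof. by case=> _ N0 h Nx; rewrite -[_ *: _]addr0; exact: h. Qed.

Lemma subspace_sum U (N : set U) (I : eqType) (s : seq I) (F : I -> U) :
  closed_subspace N -> (forall i, i \in s -> N (F i)) -> N (\sum_(i <- s) F i).
Proof.
move=> NS; elim: s => [|i s ih] NF; first by rewrite big_nil; case: NS.
rewrite big_cons; apply: subspaceD => //; first by apply: NF; rewrite mem_head.
by apply: ih => j js; apply: NF; rewrite inE js orbT.
Qed.

Lemma closure_normP U (A : set U) x :
  closure A x <-> forall e : K, 0 < e -> exists2 a, A a & `|x - a| < e.
Proof.
split=> [cA e e0|h B].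
  have [a [Aa]] := cA (ball x e) (nbhsx_ballx x e e0).
  by rewrite -ball_normE; exists a.
rewrite -nbhs_ballE => -[e /= e0 xB]; have [a Aa xa] := h e e0.
by exists a; split=> //; apply: xB; rewrite -ball_normE.
Qed.

(* The distance to N, as the least upper bound of the nonnegative lower bounds
   of the set of all |x - n|, is a seminorm vanishing on N. *)
Lemma separating_functional U (N : set U) (u : U) :
  closed_subspace N -> ~ N u ->
  exists l : dual U, (forall x, N x -> l x = 0) /\ l u != 0.
Proof.
move=> NS Nu; have [Ncl N0 Nlin] := NS.
pose L x : set K := [set a | 0 <= a /\ forall n, N n -> a <= `|x - n|].
have dP x : exists d, supremums (L x) d.
  apply: scalars_sup.
  - by exists 0; split.
  - by move=> a [].
  - by exists `|x - 0| => a [_]; exact.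
pose d x := projT1 (cid (dP x)).
have d_ub x a : L x a -> a <= d x.
  by rewrite /d; case: cid => /= s [+ _]; apply.
have d_le x n : N n -> d x <= `|x - n|.
  rewrite /d; case: cid => /= s [_ +] Nn; apply.
  by move=> a [_]; exact.
have d0 x : 0 <= d x by apply: d_ub; split.
have d_glb x a : a \is Num.real -> (forall n, N n -> a <= `|x - n|) -> a <= d x.
  move=> areal h; have [a0|a0] := real_leP (real0 _) areal.
    by apply: d_ub; split.
  by rewrite (le_trans (ltW a0)).
have dreal x : d x \is Num.real by rewrite ger0_real.
have dD x y : d (x + y) <= d x + d y.
  rewrite -lerBlDr; apply: (d_glb _ _) => [|n Nn]; first by rewrite realB.
  rewrite lerBlDr -lerBlDl; apply: (d_glb _ _) => [|m Nm].
    by rewrite realB// ger0_real.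
  rewrite lerBlDl (le_trans (d_le _ _ (subspaceD NS Nn Nm)))//.
  by rewrite opprD addrACA ler_normD.
have dZ a x : d (a *: x) <= `|a| * d x.
  have [->|a0] := eqVneq a 0.
    by rewrite scale0r normr0 mul0r (le_trans (d_le _ 0 N0))// subrr normr0.
  have na0 : 0 < `|a| by rewrite normr_gt0.
  rewrite -ler_pdivrMl//; apply: (d_glb _ _) => [|n Nn].
    by rewrite realM// realV ger0_real.
  rewrite ler_pdivrMl// -normrZ scalerBr; apply: d_le.
  exact: subspaceZ.
have [l lL [ld lu]] := seminorm_functional u d0 dD dZ.
have lB : l \in @bounded_linear R k U K^o.
  apply: (boundedBL lL (c := 1)) => x; rewrite mul1r (le_trans (ld x))//.
  by rewrite (le_trans (d_le x 0 N0))// subr0.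
exists (BLFun lB); split=> [x Nx|].
  apply/normr0_eq0/eqP; rewrite eq_le normr_ge0 andbT (le_trans (ld x))//.
  by rewrite (le_trans (d_le x x Nx))// subrr normr0.
(* If [l u] were zero, [u] would be at distance zero from the closed set [N]. *)
apply/negP => /eqP /= lu0; apply: Nu.
rewrite (closure_id N).1//; apply/closure_normP => e e0.
apply: contrapT => h; have : e <= d u.
  apply: d_ub; split; first exact: ltW.
  move=> n Nn; have [//|une] := real_leP (gtr0_real e0) (normr_real (u - n)).
  by case: h; exists n.
by rewrite -lu lu0 normr0 => /(lt_le_trans e0); rewrite ltxx.
Qed.

Lemma rank_one_subproof U V (y : V) (m : dual U) :
  (fun x => m x *: y) \in @bounded_linear R k U V.
Proof.
apply: (boundedBL (c := `|m| * `|y|)).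
  by move=> a u v; rewrite linearP scalerDl -scalerA.
by move=> x; rewrite normrZ mulrAC ler_wpM2r// le_opnorm.
Qed.

Definition rank_one U V (y : V) (m : dual U) : blfun U V :=
  BLFun (rank_one_subproof y m).

(** The coefficients in [finite_rank] carry no continuity, so bounded ones are built by induction:
    if [m (e ord0) = 1], subtracting the rank-one operator with vector [e ord0] and functional
    [m \o T] leaves values in the span of the vectors [e i - m (e i) *: e ord0], one fewer. *)
Lemma finite_rank_decomposition U V (T : blfun U V) : finite_rank T ->
  exists s : seq (V * dual U), T = \sum_(p <- s) rank_one p.1 p.2.
Proof.
move=> [n]; elim: n T => [|n ih] T [e eT].
  exists [::]; rewrite big_nil; apply: blfun_ext => x.
  by have [a ->] := eT x; rewrite big_ord0.
have [e0|/ex_functional_eq1[m m1]] := eqVneq (e ord0) 0.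
  apply: ih; exists (e \o lift ord0) => x; have [a ->] := eT x.
  by exists (a \o lift ord0); rewrite big_ord_recl e0 scaler0 add0r.
pose T' := T - rank_one (e ord0) (blcomp m T).
have [|s sE] := ih T'.
  exists (fun i => e (lift ord0 i) - m (e (lift ord0 i)) *: e ord0) => x.
  have [a aE] := eT x; exists (a \o lift ord0).
  have -> : T' x = T x - m (T x) *: e ord0 by [].
  rewrite aE linear_sum scaler_suml !big_ord_recl /= dualZ m1.
  rewrite mulr1 opprD addrACA subrr add0r -sumrB.
  apply: eq_bigr => i _; rewrite scalerBr scalerA; congr (_ - _ *: _).
  exact: dualZ.
exists ((e ord0, blcomp m T) :: s).
by rewrite big_cons -sE /= addrC subrK.
Qed.

(** If 0 is not a cluster point of the filter, some member of the filter avoids a ball around 0.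
    Outside that ball only the finitely many points of the first blocks remain, and a finite set is
    compact. *)
Lemma null_sequence_compact U (s : nat -> seq U) :
  (forall n x, x \in s n -> `|x| <= 2 ^- n) ->
  compact ([set 0] `|` \bigcup_n [set` s n]).
Proof.
move=> s_le F FF FC; have [F0|] := pselect (cluster F 0).
  by exists 0; split=> //; left.
move=> /existsNP[A /existsNP[B /not_implyP[FA /not_implyP[]]]].
rewrite -nbhs_ballE => -[e /= e0 eB] AB0.
have [n ne] := ex_pow2_lt e0.
have /finite_compact : finite_set (\bigcup_(i in `I_n) [set` s i]).
  by apply: bigcup_finite => // i _; exact: finite_seq.
case/(_ F FF); last by move=> x [[i _ ix] Fx]; exists x; split=> //; right; exists i.
apply: filterS (filterI FA FC) => x [Ax xC]; apply: contrapT => xn.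
apply: AB0; exists x; split=> //; apply: eB; rewrite -ball_normE /= sub0r normrN.
case: xC => [->|[i _ /= ix]]; first by rewrite normr0.
rewrite (le_lt_trans (s_le _ _ ix))// (le_lt_trans _ ne)//.
rewrite lef_pV2 ?posrE ?exprn_gt0// ler_eXn2l// ?ltr1n//.
by rewrite leqNgt; apply/negP => iltn; apply: xn; exists i.
Qed.

End functional_analysis.

Lemma exp2VS (F : numFieldType) n : 2 ^- n = 2 * 2 ^- n.+1 :> F.
Proof. by rewrite exprS invfM mulVKf// pnatr_eq0. Qed.

(** * Representations of elements of the projective tensor product *)

Section projective.
Context {R : realType} {k : scalar_kind}.
Local Notation K := (scalars R k).
Variables (U V : normedModType K) (P : projective_tensor U V).

Let S (s : seq (U * V)) : P := \sum_(p <- s) tens P p.1 p.2.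

Lemma tensors_dense (u : P) (e : K) : 0 < e ->
  exists s : seq (U * V), `|u - \sum_(p <- s) tens P p.1 p.2| < e.
Proof.
move=> e0; have [||x [ux [s _ sx]]] := @tens_dense _ _ _ _ P (ball u e).
- by exists u; exact: ballxx.
- exact: ball_open.
by exists s; move: ux; rewrite -ball_normE /= -sx.
Qed.

Lemma cheap_representation (s : seq (U * V)) (e : K) : 0 < e ->
  exists2 s' : seq (U * V),
    \sum_(p <- s') tens P p.1 p.2 = \sum_(p <- s) tens P p.1 p.2 &
    \sum_(p <- s') `|p.1| * `|p.2| <= `|\sum_(p <- s) tens P p.1 p.2| + e.
Proof.
move=> e0; have [_ inf_s] := tens_norm P s.
have sum0 (t : seq (U * V)) : 0 <= \sum_(p <- t) `|p.1| * `|p.2|.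
  by apply: sumr_ge0 => p _; rewrite mulr_ge0.
apply: contrapT => h; have /inf_s : lbound (projective_costs s) (`|S s| + e).
  move=> _ [s' ss' <-].
  have [||//|lt] := @real_leP _ (`|S s| + e) (\sum_(p <- s') `|p.1| * `|p.2|).
  - by rewrite realD ?normr_real ?gtr0_real.
  - exact: ger0_real.
  by case: h; exists s'; [rewrite (ss' _ (tens P))|exact: ltW].
by rewrite gerDl (lt_geF e0).
Qed.

(** Nearly optimal representations carry the constant [c] over to finite sums without loss; density
    and boundedness of [f] extend it to [P]. *)
Lemma le_of_tens W (f : blfun P W) (c : K) : 0 <= c ->
  (forall x y, `|f (tens P x y)| <= c * (`|x| * `|y|)) ->
  forall u, `|f u| <= c * `|u|.
Proof.
move=> c0 fc u; have [M M0 fM] := blfun_bounded f.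
have fS s : `|f (S s)| <= c * `|S s|.
  apply/ler_addgt0Pr => e e0.
  have c1 : 0 < c + 1 by rewrite ltr_wpDl.
  have [s' s'E cs'] := @cheap_representation s (e / (c + 1)) (divr_gt0 e0 c1).
  rewrite -{1}[S s]s'E linear_sum (le_trans (ler_norm_sum _ _ _))//.
  apply: (@le_trans _ _ (c * \sum_(p <- s') `|p.1| * `|p.2|)).
    by rewrite mulr_sumr; apply: ler_sum => p _; exact: fc.
  rewrite (le_trans (ler_wpM2l c0 cs'))// mulrDr lerD2l.
  by rewrite mulrCA ler_piMr ?(ltW e0)// ler_pdivrMr// mul1r lerDl.
apply/ler_addgt0Pr => e e0; pose d := e / (M + c + 1).
have D0 : 0 < M + c + 1 by rewrite ltr_wpDl// addr_ge0.
have d0 : 0 < d by rewrite divr_gt0.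
have [s us] := tensors_dense u d0.
have -> : f u = f (u - S s) + f (S s) by rewrite -linearD subrK.
rewrite (le_trans (ler_normD _ _))//.
have Ss : `|S s| <= `|u| + d.
  by rewrite -[S s](subKr u) (le_trans (ler_normB _ _))// lerD// ltW.
apply: (@le_trans _ _ (M * d + c * (`|u| + d))).
  apply: lerD; first by rewrite (le_trans (fM _))// ler_wpM2l// ltW.
  by rewrite (le_trans (fS s))// ler_wpM2l.
rewrite mulrDr addrCA lerD2l -mulrDl /d mulrCA ler_piMr ?(ltW e0)//.
by rewrite ler_pdivrMr// mul1r lerDl.
Qed.

(* Every tensor is an absolutely convergent series of elementary tensors; the
   terms are grouped in blocks [s n] and rescaled so that their first factors
   form a null sequence. *)
Lemma null_representation (u : P) :
  exists (s : nat -> seq (U * V)) (M : K), [/\ 0 <= M,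
    forall n p, p \in s n -> `|p.1| <= 2 ^- n,
    forall n, \sum_(p <- s n) `|p.2| <= M * 2 ^- n &
    forall n, `|u - \sum_(i < n) \sum_(p <- s i) tens P p.1 p.2| <= M * 2 ^- n].
Proof.
have pow0 n : 0 < 2 ^- n :> K by rewrite invr_gt0 exprn_gt0.
(* Of the rate [4 ^- n], one factor [2 ^- n] is given to the first tensor factors and the other is
   kept for the sums of the second ones. *)
have /choice[t ut] : forall n, exists t, `|u - S t| < 2 ^- n * 2 ^- n.
  by move=> n; apply: tensors_dense; rewrite mulr_gt0.
(* The terms [|u|] and [|S (t 0)|] serve the index 0. Later, in units of [4 ^- n.+1], the increment
   costs 1 + 4 and the slack of its representation 1, which gives 6. *)
pose M : K := `|u| + (`|S (t 0)| + 6).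
have M0 : 0 <= M by rewrite !addr_ge0.
(* Telescoping increments: the first [n.+1] of them sum to [S (t n)], the empty sum being 0. *)
pose D n : P := S (t n) - (if n is m.+1 then S (t m) else 0).
have DE n : \sum_(i < n) D i = if n is m.+1 then S (t m) else 0.
  elim: n => [|n ih]; first by rewrite big_ord0.
  by rewrite big_ord_recr /= ih /D addrC subrK.
have D_le n : `|D n| + 2 ^- n * 2 ^- n <= M * (2 ^- n * 2 ^- n).
  case: n => [|n].
    rewrite /D subr0 expr0 invr1 !mulr1 (@le_trans _ _ (`|S (t 0)| + 6))//.
      by rewrite lerD2l ler1n.
    by rewrite /M lerDr.
  have q0 : 0 <= 2 ^- n.+1 * 2 ^- n.+1 :> K by rewrite mulr_ge0// ltW.
  apply: (@le_trans _ _ (6 * (2 ^- n.+1 * 2 ^- n.+1))); last first.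
    by rewrite ler_wpM2r// /M addrA lerDr addr_ge0.
  have -> : 6 * (2 ^- n.+1 * 2 ^- n.+1) = 2 ^- n.+1 * 2 ^- n.+1 +
      2 ^- n * 2 ^- n + 2 ^- n.+1 * 2 ^- n.+1 :> K.
    by rewrite (exp2VS _ n); ring.
  rewrite lerD2r /D -(subrKA u) (le_trans (ler_normD _ _))//.
  by rewrite distrC lerD// ltW.
have /choice[s' /all_and2[s'E s'_le]] : forall n, exists s' : seq (U * V),
    S s' = D n /\ \sum_(p <- s') `|p.1| * `|p.2| <= M * (2 ^- n * 2 ^- n).
  move=> n.
  have [r rE] : exists r, S r = D n.
    case: n => [|n]; first by exists (t 0%N); rewrite /D subr0.
    exists (t n.+1 ++ [seq (- p.1, p.2) | p <- t n]).
    rewrite /S big_cat big_map /= /D; congr (_ + _).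
    by rewrite -sumrN; apply: eq_bigr => p _; rewrite linearNl.
  have q0 : 0 < 2 ^- n * 2 ^- n :> K by rewrite mulr_gt0.
  have [r' r'E r'_le] := cheap_representation r q0.
  exists r'; split; first by rewrite -rE.
  by rewrite (le_trans r'_le)// -/(S r) rE.
(* Reciprocal scalings keep the tensor and give the first factor norm [2 ^- n]. A pair with zero
   first factor is replaced by zeros, so that it adds nothing to the sum of the second norms. *)
pose f n (p : U * V) : U * V := if p.1 == 0 then (0, 0) else
  ((2 ^- n / `|p.1|) *: p.1, (2 ^+ n * `|p.1|) *: p.2).
exists (fun n => [seq f n p | p <- s' n]), M; split=> //.
- move=> n _ /mapP[p _ ->]; rewrite /f; case: ifPn => [_|p0] /=.
    by rewrite normr0 ltW.
  rewrite normrZ ger0_norm ?divr_ge0//; last exact: ltW.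
  by rewrite divfK ?normr_eq0.
- move=> n; rewrite big_map.
  rewrite -(@ler_pM2r _ (2 ^- n))// -mulrA; apply: le_trans (s'_le n).
  rewrite mulr_suml; apply: ler_sum => p _; rewrite /f; case: ifPn => [_|p0] /=.
    by rewrite normr0 mul0r mulr_ge0.
  rewrite normrZ normrM normr_id ger0_norm ?exprn_ge0//.
  rewrite mulrC !mulrA mulVf ?mul1r// expf_neq0// pnatr_eq0//.
- move=> n.
  have -> : \sum_(i < n) \sum_(p <- [seq f i p | p <- s' i]) tens P p.1 p.2 =
      \sum_(i < n) D i.
    apply: eq_bigr => i _; rewrite -s'E big_map; apply: eq_bigr => p _.
    rewrite /f; case: eqP => [->|/eqP p0] /=; first by rewrite !linear0l.
    rewrite linearZl linearZr /= scalerA mulrACA !mulVf ?normr_eq0 ?expf_neq0 ?pnatr_eq0//.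
    by rewrite mul1r scale1r.
  rewrite DE; case: n => [|n].
    by rewrite subr0 expr0 invr1 mulr1 /M lerDl addr_ge0.
  apply: (le_trans (ltW (ut n))).
  apply: (@le_trans _ _ (6 * 2 ^- n.+1)); last first.
    by rewrite ler_wpM2r ?(ltW (pow0 _))// /M addrA lerDr addr_ge0.
  have -> : 6 * 2 ^- n.+1 = 3 * 2 ^- n :> K.
    by rewrite (exp2VS _ n); ring.
  rewrite ler_wpM2r ?(ltW (pow0 _))// (@le_trans _ _ 1)// ?ler1n//.
  by rewrite invf_le1 ?exprn_gt0// exprn_ege1// ler1n.
Qed.

End projective.

(** * Closed subspaces and closures of algebraic tensor products *)

Section subspaces.
Context {R : realType} {k : scalar_kind}.
Local Notation K := (scalars R k).
Implicit Types U V W : normedModType K.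

Lemma closed_subspace_setT U : closed_subspace [set: U].
Proof. by split=> //; exact: closedT. Qed.

Lemma closure_subspace U (A : set U) : A 0 ->
  (forall (a : K) x y, A x -> A y -> A (a *: x + y)) ->
  closed_subspace (closure A).
Proof.
move=> A0 Alin; split=> [||a x y /closure_normP Ax /closure_normP Ay].
- exact: closed_closure.
- exact: subset_closure.
apply/closure_normP => e e0; pose d := e / (`|a| + 1).
have D0 : 0 < `|a| + 1 by rewrite ltr_wpDl.
have d0 : 0 < d by rewrite divr_gt0.
have [x' Ax' xx'] := Ax d d0; have [y' Ay' yy'] := Ay d d0.
exists (a *: x' + y'); first exact: Alin.
rewrite opprD addrACA -scalerBr (le_lt_trans (ler_normD _ _))// normrZ.
have -> : e = `|a| * d + d by rewrite -{2}[d]mul1r -mulrDl mulrC divfK// gt_eqF.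
by rewrite ler_ltD// ler_wpM2l// ltW.
Qed.

Lemma preimage_subspace U V (f : blfun U V) (N : set V) :
  closed_subspace N -> closed_subspace (f @^-1` N).
Proof.
move=> NS; have [Ncl N0 Nlin] := NS; split=> [||a x y Nx Ny].
- by apply: preimage_closed => // x _; exact: blfun_continuous.
- by rewrite /= linear0.
- by rewrite /= linearP; exact: Nlin.
Qed.

Lemma tensor_closure_subspace U V (P : projective_tensor U V)
    (A : set U) (B : set V) : closed_subspace A ->
  closed_subspace (tensor_closure P A B).
Proof.
move=> AS; apply: closure_subspace; first by exists [::]; rewrite ?big_nil.
move=> a _ _ [s sAB <-] [t tAB <-].
exists ([seq (a *: p.1, p.2) | p <- s] ++ t); last first.
  rewrite big_cat big_map /= scaler_sumr; congr (_ + _).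
  by apply: eq_bigr => p _; rewrite linearZl.
move=> p; rewrite mem_cat => /orP[/mapP[q /sAB[Aq Bq] ->]|/tAB//].
by split=> //; exact: subspaceZ.
Qed.

Lemma tensor_closure_tens U V (P : projective_tensor U V)
    (A : set U) (B : set V) x y : A x -> B y ->
  tensor_closure P A B (tens P x y).
Proof.
move=> Ax By; apply: subset_closure; exists [:: (x, y)]; rewrite ?big_seq1//.
by move=> p; rewrite inE => /eqP->.
Qed.

Lemma tensor_closure_sub U V (P : projective_tensor U V)
    (A : set U) (B : set V) (N : set P) : closed_subspace N ->
  (forall x y, A x -> B y -> N (tens P x y)) -> tensor_closure P A B `<=` N.
Proof.
move=> NS h; rewrite [X in _ `<=` X](closure_id N).1; last by case: NS.
apply: closure_subset => _ [s sAB <-].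
by apply: subspace_sum => // p /sAB[]; exact: h.
Qed.

End subspaces.

(** * The trace, approximation by finite-rank actions, and slices *)

Section bimodule.
Context {R : realType} {k : scalar_kind}.
Local Notation K := (scalars R k).
Variables (E : completeNormedModType K) (P : projective_tensor E (dual E)).
Implicit Types (T S : blfun E E) (u : P) (x y : E) (l m : dual E).

Lemma lactP a T S u : lact P (a *: T + S) u = a *: lact P T u + lact P S u.
Proof.
have -> : lact P (a *: T + S) = a *: lact P T + lact P S; last by [].
apply: tens_ext => x l; rewrite lactE.
have -> : (a *: T + S) x = a *: T x + S x by [].
by rewrite linearPl -!lactE.
Qed.

Lemma lact_sum (I : Type) (s : seq I) (T : I -> blfun E E) u :
  lact P (\sum_(i <- s) T i) u = \sum_(i <- s) lact P (T i) u.
Proof.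
have l0 : lact P 0 u = 0.
  by have := lactP (-1) 0 0 u; rewrite scaler0 addr0 scaleN1r addNr.
elim: s => [|i s ih]; first by rewrite !big_nil.
by rewrite !big_cons -[T i]scale1r lactP ih !scale1r.
Qed.

(** The lift is taken into the complete space [E], along a nonzero vector [e], and a functional [m]
    with [m e = 1] reads off the scalar. If [E] is zero, so is every [l x]. *)
Lemma trace_exists : exists t : dual P, forall x l, t (tens P x l) = l x.
Proof.
have [[e e0]|E0] := pselect (exists e : E, e != 0); last first.
  exists 0 => x l; have -> : x = 0.
    by apply/eqP/negPn/negP => x0; apply: E0; exists x.
  by rewrite linear0.
have [m m1] := ex_functional_eq1 e0.
pose b x l : E := l x *: e.
have bB : bilinear_for *:%R *:%R b.
  split=> [l a x y|x a l1 l2]; rewrite /b.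
    by rewrite linearP scalerDl -scalerA.
  have -> : (a *: l1 + l2) x = a * l1 x + l2 x by [].
  by rewrite scalerDl -scalerA.
pose bb : {bilinear E -> dual E -> E} :=
  HB.pack b (bilinear_isBilinear.Build K E (dual E) E *:%R *:%R b bB).
have [|f fE] := @lift_exists _ _ _ _ P E bb `|e|.
  move=> x l; rewrite /= normrZ mulrC ler_wpM2l// mulrC.
  exact: le_opnorm.
by exists (blcomp m f) => x l; rewrite /= fE /= dualZ m1 mulr1.
Qed.

Let tr : dual P := projT1 (cid trace_exists).

Lemma trE x l : tr (tens P x l) = l x.
Proof. by rewrite /tr; case: cid => /= t ->. Qed.

Lemma tr_lact_rank_one_le y m u :
  `|tr (lact P (rank_one y m) u)| <= `|y| * `|m| * `|u|.
Proof.
apply: (@le_of_tens _ _ _ _ P K^o (blcomp tr (lact P (rank_one y m)))).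
  by rewrite mulr_ge0.
move=> x l /=; rewrite lactE trE /= dualZ normrM.
have -> : `|y| * `|m| * (`|x| * `|l|) = (`|m| * `|x|) * (`|l| * `|y|) by ring.
by apply: ler_pM => //; exact: le_opnorm.
Qed.

(** The approximation property gives no bound on [T] uniform in [e]. The tolerance [d] therefore
    depends only on [M], and the point where the series is cut is chosen after [T]. *)
Lemma lact_approximation u (e : K) : approximation_property E -> 0 < e ->
  exists2 T, finite_rank T & `|lact P T u - u| <= e.
Proof.
move=> AP e0; have [s [M [M0 s1 s2 sM]]] := null_representation u.
have M1 : 0 < 2 * M + 1 by rewrite ltr_wpDl// mulr_ge0.
pose d := e / (2 * M + 1); have d0 : 0 < d by rewrite divr_gt0.
have cptC := @null_sequence_compact _ _ E (fun n => [seq p.1 | p <- s n]).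
have [|T Tfin Td] := AP _ (cptC _) d d0.
  by move=> n _ /mapP[p /s1 + ->].
exists T => //; have [c c0 Tc] := blfun_bounded (lact P T).
have block n : `|lact P T (\sum_(p <- s n) tens P p.1 p.2) -
    \sum_(p <- s n) tens P p.1 p.2| <= d * (M * 2 ^- n).
  rewrite linear_sum -sumrB (le_trans (ler_norm_sum _ _ _))//.
  apply: le_trans (ler_wpM2l (ltW d0) (s2 n)); rewrite mulr_sumr.
  rewrite !big_seq; apply: ler_sum => p ps.
  rewrite /= lactE -linearBl (le_trans (tens_le _ _ _))//.
  rewrite ler_wpM2r// ltW// Td//; right; exists n => //=.
  by apply/mapP; exists p.
pose u_ n := \sum_(i < n) \sum_(p <- s i) tens P p.1 p.2.
(* The factor [2 - 2 * 2 ^- n] is the geometric sum of [2 ^- i] for [i < n]. It stays below 2,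
   whence the [2 * M] in [d]. *)
have partial n : `|lact P T (u_ n) - u_ n| <= d * (M * (2 - 2 * 2 ^- n)).
  elim: n => [|n ih].
    by rewrite /u_ big_ord0 linear0 subr0 normr0 expr0 invr1 mulr1 subrr !mulr0.
  rewrite /u_ big_ord_recr /= -/(u_ n) linearD opprD addrACA.
  rewrite (le_trans (ler_normD _ _))//.
  apply: (le_trans (lerD ih (block n))).
  by rewrite -!mulrDr (exp2VS _ n) le_eqVlt; apply/orP; left; apply/eqP; ring.
(* The remainder [u - u_ n] is controlled by the bound [c] of [lact P T], which is now fixed. *)
apply/ler_addgt0Pr => e' e'0.
have D0 : 0 < (c + 1) * M + 1 by rewrite ltr_wpDl// mulr_ge0// addr_ge0.
have [n ne] := ex_pow2_lt (divr_gt0 e'0 D0).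
have -> : lact P T u - u =
    (lact P T (u_ n) - u_ n) + (lact P T (u - u_ n) - (u - u_ n)).
  by rewrite linearB opprB /= addrACA subrKC addKr.
rewrite (le_trans (ler_normD _ _))// lerD//.
  rewrite (le_trans (partial n))// /d mulrAC ler_pdivrMr// ler_wpM2l ?(ltW e0)//.
  rewrite mulrBr lerBlDr [M * 2]mulrC -addrA lerDl addr_ge0 ?ler01// mulr_ge0//.
  by rewrite mulr_ge0// invr_ge0 exprn_ge0.
rewrite (le_trans (ler_normB _ _))//.
apply: (@le_trans _ _ ((c + 1) * (M * 2 ^- n))).
  rewrite mulrDl mul1r lerD ?sM// (le_trans (Tc _))// ler_wpM2l//.
  exact: sM.
rewrite mulrA; apply: le_trans (_ : ((c + 1) * M + 1) * 2 ^- n <= _).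
  by rewrite ler_wpM2r ?invr_ge0 ?exprn_ge0// lerDl.
by move: ne; rewrite ltr_pdivlMr// mulrC => /ltW.
Qed.

(** The slice [l] sends [y] to the trace of [rank_one y m] acting on [u]; for [u = tens P x l'] it
    is [m x *: l']. Both sides are bounded linear in [u], so elementary tensors decide. *)
Lemma left_slice u m :
  exists l, forall y, lact P (rank_one y m) u = tens P y l.
Proof.
have rk a y z : rank_one (a *: y + z) m = a *: rank_one y m + rank_one z m.
  apply: blfun_ext => x.
  have -> : (a *: rank_one y m + rank_one z m) x = a *: (m x *: y) + m x *: z.
    by [].
  by rewrite /= scalerDr !scalerA mulrC.
have slB v : (fun y => tr (lact P (rank_one y m) v)) \in
    @bounded_linear R k E K^o.
  apply: (boundedBL (c := `|m| * `|v|)) => [a y z|y].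
    by rewrite rk lactP linearP.
  by rewrite (le_trans (tr_lact_rank_one_le _ _ _))// mulrC mulrA mulrC mulrA.
pose sl v : dual E := BLFun (slB v).
have slL a v w : sl (a *: v + w) = a *: sl v + sl w.
  by apply: blfun_ext => y /=; rewrite !linearP.
have sl_le v : `|sl v| <= `|m| * `|v|.
  apply: opnorm_le => [|y]; first by rewrite mulr_ge0.
  by rewrite (le_trans (tr_lact_rank_one_le _ _ _))// mulrC mulrA mulrC mulrA.
exists (sl u) => y.
have gB : (fun v => tens P y (sl v)) \in @bounded_linear R k P P.
  apply: (boundedBL (c := `|y| * `|m|)) => [a v w|v].
    by rewrite slL linearPr.
  by rewrite (le_trans (tens_le _ _ _))// -mulrA ler_wpM2l.
suff -> : lact P (rank_one y m) = BLFun gB by [].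
apply: tens_ext => x l; rewrite lactE /= linearZl -linearZr; congr (tens P y _).
by apply: blfun_ext => z; rewrite /= lactE trE /= dualZ.
Qed.

(** Evaluating the second factor at [y] gives the slice, since [l] composed with [rank_one y m] is
    [l y *: m]. The same slice serves every [m]. *)
Lemma right_slice y : exists sl : blfun P E,
  (forall x l, sl (tens P x l) = l y *: x) /\
  forall m u, ract P (rank_one y m) u = tens P (sl u) m.
Proof.
pose b x l : E := l y *: x.
have bB : bilinear_for *:%R *:%R b.
  split=> [l a x z|x a l1 l2]; rewrite /b.
    by rewrite scalerDr scalerA mulrC -scalerA.
  have -> : (a *: l1 + l2) y = a * l1 y + l2 y by [].
  by rewrite scalerDl -scalerA.
pose bb : {bilinear E -> dual E -> E} :=
  HB.pack b (bilinear_isBilinear.Build K E (dual E) E *:%R *:%R b bB).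
have [|f fE] := @lift_exists _ _ _ _ P E bb `|y|.
  move=> x l; rewrite /= normrZ mulrCA mulrC ler_wpM2l// mulrC.
  exact: le_opnorm.
exists f; split=> // m u.
have gB : (fun v => tens P (f v) m) \in @bounded_linear R k P P.
  have [c c0 fc] := blfun_bounded f.
  apply: (boundedBL (c := c * `|m|)) => [a v w|v].
    by rewrite linearP linearPl.
  by rewrite (le_trans (tens_le _ _ _))// mulrAC ler_wpM2r.
suff -> : ract P (rank_one y m) = BLFun gB by [].
apply: tens_ext => x l; rewrite ractE /= fE /b /= linearZl -linearZr.
congr (tens P x _); apply: blfun_ext => z.
have -> : (l y *: m) z = l y * m z by [].
by rewrite /= dualZ mulrC.
Qed.

End bimodule.

(** * Factor spaces and the two descriptions of submodules *)

Section submodules.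
Context {R : realType} {k : scalar_kind}.
Local Notation K := (scalars R k).
Implicit Types U V W : normedModType K.

Lemma bigcap_subspace U (I : Type) (N : I -> set U) :
  (forall i, closed_subspace (N i)) -> closed_subspace (\bigcap_i N i).
Proof.
move=> NS; split=> [|i _|a x y Nx Ny i _].
- by apply: closed_bigI => i _; case: (NS i).
- by case: (NS i).
- by case: (NS i) => _ _; apply; [exact: Nx|exact: Ny].
Qed.

Variables (E : completeNormedModType K) (P : projective_tensor E (dual E)).

Lemma tensl_subproof (l : dual E) :
  (fun x => tens P x l) \in @bounded_linear R k E P.
Proof.
apply: (boundedBL (c := `|l|)) => [a x y|x]; first by rewrite linearPl.
by rewrite mulrC tens_le.
Qed.

Lemma tensr_subproof (x : E) :
  (fun l => tens P x l) \in @bounded_linear R k (dual E) P.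
Proof.
apply: (boundedBL (c := `|x|)) => [a l m|l]; first by rewrite linearPr.
exact: tens_le.
Qed.

(** As an intersection of preimages under bounded operators, it inherits from [M] the property of
    being a closed subspace. *)
Definition left_factors (M : set P) : set E :=
  \bigcap_l (BLFun (tensl_subproof l) @^-1` M).

Definition right_factors (M : set P) : set (dual E) :=
  \bigcap_x (BLFun (tensr_subproof x) @^-1` M).

Lemma left_factors_subspace M :
  closed_subspace M -> closed_subspace (left_factors M).
Proof. by move=> MS; apply: bigcap_subspace => l; exact: preimage_subspace. Qed.

Lemma right_factors_subspace M :
  closed_subspace M -> closed_subspace (right_factors M).
Proof. by move=> MS; apply: bigcap_subspace => l; exact: preimage_subspace. Qed.

Lemma tensor_closure_right_submodule (F : set E) :
  closed_subspace F -> closed_right_submodule (tensor_closure P F setT).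
Proof.
move=> FS; have CS := tensor_closure_subspace P setT FS.
split=> // T; apply: tensor_closure_sub; first exact: preimage_subspace.
by move=> x l Fx _ /=; rewrite ractE; exact: tensor_closure_tens.
Qed.

Lemma tensor_closure_left_submodule (D : set (dual E)) :
  closed_left_submodule (tensor_closure P setT D).
Proof.
have CS := tensor_closure_subspace P D (closed_subspace_setT E).
split=> // T; apply: tensor_closure_sub; first exact: preimage_subspace.
by move=> x l _ Dl /=; rewrite lactE; exact: tensor_closure_tens.
Qed.

Lemma left_submoduleE (M : set P) : approximation_property E ->
  closed_left_submodule M -> M = tensor_closure P setT (right_factors M).
Proof.
move=> AP [MS Mlact]; apply/seteqP; split=> [u Mu|]; last first.
  by apply: tensor_closure_sub => // x l _; exact.
have [CS _] := tensor_closure_left_submodule (right_factors M).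
have [Ccl _ _] := CS; rewrite ((closure_id _).1 Ccl); apply/closure_normP => e e0.
(* Half of [e] turns the weak inequality of the approximation into a strict one. *)
have [T Tfin Te] := lact_approximation u AP (divr_gt0 e0 (ltr0Sn _ 1)).
exists (lact P T u); last first.
  by rewrite distrC (le_lt_trans Te)// ltr_pdivrMr// ltr_pMr// ltr1n.
have [s ->] := finite_rank_decomposition Tfin; rewrite lact_sum.
apply: subspace_sum => // -[y m] _ /=; have [l lE] := left_slice u m.
(* The slice [l] does not depend on [y]: for every [z], [tens P z l] is [rank_one z m] acting on
   [u], an element of [M]. *)
rewrite lE; apply: tensor_closure_tens => // z _ /=.
by rewrite -lE; exact: Mlact.
Qed.

(* By reflexivity the dual of P is B(E), through [phi (x (x) l) = l (S x)]. *)
Lemma reflexive_functional (phi : dual P) : reflexive_space E ->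
  exists S : blfun E E, forall x l, phi (tens P x l) = l (S x).
Proof.
move=> refl.
have /choice[S SE] x : exists Sx : E, forall l : dual E,
    phi (tens P x l) = l Sx.
  have [Sx SxE] := refl (blcomp phi (BLFun (tensr_subproof x))).
  by exists Sx => l; rewrite -SxE.
have SL : linear S.
  move=> a x y; apply/subr0_eq/dual_separating => l.
  by rewrite linearB linearP /= -!SE linearPl linearP subrr.
have [c c0 phic] := blfun_bounded phi.
have SB : S \in @bounded_linear R k E E.
  apply: (boundedBL (c := c) SL) => x.
  (* A norming functional of [S x] has norm at most 1, so the bound of [phi] also bounds [S]. *)
  have [l [l1 <-]] := norming_functional (S x).
  rewrite -SE (le_trans (phic _))// ler_wpM2l// (le_trans (tens_le _ _ _))//.
  rewrite ler_piMr//; apply: opnorm_le => // z; by rewrite mul1r.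
by exists (BLFun SB).
Qed.

(* Applying the approximation property to [S u], where S in B(E) represents a
   functional [phi] vanishing on F (x) E', gives phi(u) = tr(S u) = 0. *)
Lemma right_submoduleE (M : set P) :
  reflexive_space E -> approximation_property E ->
  closed_right_submodule M -> M = tensor_closure P (left_factors M) setT.
Proof.
move=> refl AP [MS Mract]; apply/seteqP; split=> [u Mu|]; last first.
  by apply: tensor_closure_sub => // x l + _; exact.
have FS := left_factors_subspace MS.
have CS := tensor_closure_subspace P setT FS.
apply: contrapT => Nu; have [phi [phiC /eqP]] := separating_functional CS Nu.
apply; have [S SE] := reflexive_functional phi refl.
have [t tE] := trace_exists P.
have phiE : phi = blcomp t (lact P S).
  by apply: tens_ext => x l; rewrite SE /= lactE tE.
have [c c0 tc] := blfun_bounded t.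
have t0 y m : t (lact P (rank_one y m) (lact P S u)) = 0.
  have [sl [slE slr]] := right_slice P y.
  (* On [tens P x l] both sides equal [m (S x) * l y]. *)
  have -> : t (lact P (rank_one y m) (lact P S u)) =
      phi (ract P (rank_one y m) u).
    suff /(congr1 (fun f : dual P => f u)) :
      blcomp t (blcomp (lact P (rank_one y m)) (lact P S)) =
      blcomp phi (ract P (rank_one y m)) by [].
    apply: tens_ext => x l; rewrite /= ractE !lactE SE tE /= !dualZ.
    by rewrite mulrC.
  (* The slice [sl u] is a left factor of [M]: for every [l], [tens P (sl u) l] is [u] acted on by
     [rank_one y l]. *)
  apply: phiC; rewrite slr; apply: tensor_closure_tens => // l _ /=.
  by rewrite -slr; exact: Mract.
rewrite phiE /=; apply/normr0_eq0/eqP; rewrite eq_le normr_ge0 andbT.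
apply/ler_addgt0Pr => e e0; rewrite add0r.
have c1 : 0 < c + 1 by rewrite ltr_wpDl.
have [T Tfin Te] := lact_approximation (lact P S u) AP (divr_gt0 e0 c1).
have tT : t (lact P T (lact P S u)) = 0.
  have [s ->] := finite_rank_decomposition Tfin.
  by rewrite lact_sum linear_sum big1// => -[y m] _; exact: t0.
rewrite -normrN -[- _]add0r -tT -linearB (le_trans (tc _))//.
apply: le_trans (ler_wpM2l c0 Te) _.
by rewrite mulrCA ler_piMr ?(ltW e0)// ler_pdivrMr// mul1r lerDl.
Qed.

End submodules.

Theorem corollary6p5 (R : realType) (k : scalar_kind)
    (E : completeNormedModType (scalars R k))
    (P : projective_tensor E (dual E)) :
  reflexive_space E -> approximation_property E ->
  (forall M : set P, closed_right_submodule M <->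
     exists2 F : set E, closed_subspace F & M = tensor_closure P F setT) /\
  (forall M : set P, closed_left_submodule M <->
     exists2 D : set (dual E), closed_subspace D & M = tensor_closure P setT D).
Proof.
move=> refl AP; split=> M; split.
- move=> MS; exists (left_factors M); last exact: right_submoduleE.
  by apply: left_factors_subspace; case: MS.
- by move=> [F FS ->]; exact: tensor_closure_right_submodule.
- move=> MS; exists (right_factors M); last exact: left_submoduleE.
  by apply: right_factors_subspace; case: MS.
- by move=> [D _ ->]; exact: tensor_closure_left_submodule.
Qed.
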